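(* Let $d\ge 1$ be an integer. There exists a constant $C$ depending only on $d$ such that for all $0\le\alpha\le\tfrac12$, all $0<p\le 1$ and all mean $(\alpha,p)$-porous Radon measures $\mu$ on $\mathbb{R}^d$, \[ \dim_{\mathrm p}\mu\le d-p+\frac{C}{\log\left(\frac{1}{1-2\alpha}\right)}, \] where for $\alpha=0$ the last term is read as $+\infty$ and for $\alpha=\tfrac12$ it is read as $0$.
   Context: $B(x,r)$ denotes the closed ball in $\mathbb{R}^d$ with centre $x$ and radius $r$. For a Radon measure $\mu$ on $\mathbb{R}^d$, $x\in\mathbb{R}^d$ and $r,\varepsilon>0$, set \[ \mathrm{por}(\mu,x,r,\varepsilon)=\sup\{\alpha\ge 0 : \text{there is } z\in\mathbb{R}^d \text{ with } B(z,\alpha r)\subset B(x,r)\text{ and }\mu(B(z,\alpha r))\le\varepsilon\mu(B(x,r))\}. \] The measure $\mu$ is mean $(\alpha,p)$-porous at $x$ if \[ \lim_{\varepsilon\to 0}\liminf_{i\to\infty}\frac{\#\{1\le j\le i : \mathrm{por}(\mu,x,2^{-j},\varepsilon)\ge\alpha\}}{i}\ge p, \] and $\mu$ is mean $(\alpha,p)$-porous if there is $A\subset\mathbb{R}^d$ with $\mu(A)>0$ such that $\mu$ is mean $(\alpha,p)$-porous at every $x\in A$. (For non-measurable sets, $\mu$ is understood as an outer measure.) The packing dimension of $\mu$ is the $\mu$-essential infimum \[ \dim_{\mathrm p}\mu=\mu\text{-}\operatorname*{ess\,inf}_{x\in\mathbb{R}^d}\ \limsup_{r\downarrow 0}\frac{\log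 \mu(B(x,r))}{\log r}. \] *)

(* Defs.v *)
From HB Require Import structures.
From mathcomp Require Import all_boot all_order all_algebra.
From mathcomp Require Import all_classical all_reals all_analysis.
From mathcomp Require Import ess_sup_inf.

Set Implicit Arguments.
Unset Strict Implicit.
Unset Printing Implicit Defensive.

Import Order.TTheory GRing.Theory Num.Theory.
Import numFieldNormedType.Exports.

Local Open Scope classical_set_scope.
Local Open Scope ring_scope.

(* The library norm on ['rV[R]_d] is the sup norm, so the Euclidean distance is
   spelled out; the two induce the same topology, hence the library's [open] and
   [compact] are the usual ones. *)
Definition edist (R : realType) (d : nat) (x y : 'rV[R]_d) : R :=
  Num.sqrt (\sum_(i < d) (x ord0 i - y ord0 i) ^+ 2).

Definition cball (R : realType) (d : nat) (x : 'rV[R]_d) (r : R) :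
    set 'rV[R]_d :=
  [set y | edist x y <= r].

(* R^d with its Borel sigma-algebra. *)
Notation borelRd R d := (g_sigma_algebraType (@open 'rV[R]_d)).

Definition radon (R : realType) (d : nat)
    (mu : {measure set (borelRd R d) -> \bar R}) : Prop :=
  [/\ forall K : set 'rV[R]_d, compact K -> (mu K < +oo)%E,
      forall U : set 'rV[R]_d, open U ->
        mu U = ereal_sup [set mu K | K in
                 [set K : set 'rV[R]_d | compact K /\ K `<=` U]]
    & forall A : set (borelRd R d), measurable A ->
        mu A = ereal_inf [set mu U | U in
                 [set U : set 'rV[R]_d | open U /\ A `<=` U]]].

(* The set below is bounded above by 1 when [0 < r]; it contains 0 as soon as
   some point [z] of the ball satisfies [mu [set z] <= e * mu (cball x r)]. *)
Definition por (R : realType) (d : nat)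
    (mu : {measure set (borelRd R d) -> \bar R})
    (x : 'rV[R]_d) (r e : R) : R :=
  sup [set a : R | 0 <= a /\ exists z : 'rV[R]_d,
        cball z (a * r) `<=` cball x r /\
        (mu (cball z (a * r)) <= e%:E * mu (cball x r))%E].

Definition porous_scales (R : realType) (d : nat)
    (mu : {measure set (borelRd R d) -> \bar R})
    (x : 'rV[R]_d) (a e : R) (i : nat) : nat :=
  count (fun j : nat => a <= por mu x (2 ^- j) e) (iota 1 i).

(* The lower density of porous scales is nondecreasing in [e], so the one-sided
   limit as [e] decreases to 0 always exists. *)
Definition mean_porous_at (R : realType) (d : nat)
    (mu : {measure set (borelRd R d) -> \bar R})
    (a p : R) (x : 'rV[R]_d) : Prop :=
  (p%:E <= lim (limn_einf (fun i : nat =>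
                  ((porous_scales mu x a e i)%:R / i%:R)%:E) @[e --> 0^'+]))%E.

(* [A] need not be measurable: [mu_ext mu] is the outer measure induced by
   [mu]. *)
Definition mean_porous (R : realType) (d : nat)
    (mu : {measure set (borelRd R d) -> \bar R}) (a p : R) : Prop :=
  exists A : set 'rV[R]_d,
    (0 < mu_ext mu A)%E /\ forall x, A x -> mean_porous_at mu a p x.

(* [lne 0 = -oo], so for [r < 1] the quotient is [+oo] when the ball is null. *)
Definition upper_local_dim (R : realType) (d : nat)
    (mu : {measure set (borelRd R d) -> \bar R}) (x : 'rV[R]_d) : \bar R :=
  limf_esup (fun r : R => (lne (mu (cball x r)) * ((ln r)^-1)%:E)%E) 0^'+.

Definition packing_dim (R : realType) (d : nat)
    (mu : {measure set (borelRd R d) -> \bar R}) : \bar R :=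
  ess_inf mu (upper_local_dim mu).

Definition porosity_error (R : realType) (C a : R) : \bar R :=
  if a == 0 then +oo%E
  else if a == 2^-1 then 0%E
  else (C / ln (1 / (1 - 2 * a)))%:E.

(* Main.v *)
Require Import Defs.
From mathcomp Require Import all_boot all_order all_algebra.
From mathcomp Require Import all_classical all_reals all_analysis.
From mathcomp Require Import ess_sup_inf.
From mathcomp Require Import ring lra zify.
(* [all_analysis] exports another [edist]. *)
Import Defs.

(* Fix k and look only at the scales 2^-(m+lk), l = 0, 1, ..., for one residue m
   modulo k. If a hole has radius at least (1/2 - 2^-k) times the scale r, then
   the points having such a hole, but lying well inside no hole of a point of
   their own grid cell, are within O(2^-k r) of a graph over a coordinate
   hyperplane: a cell of side ~ r has 2^(kd) subcells of side ~ 2^-k r, and only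
   O(2^(k(d-1))) of them meet these "exposed" points. Counting cells and applying
   Borel-Cantelli, almost every x satisfies, for all large M,
     mu(B(x, 2^-(m+Mk))) >= 2^(kt) / (c^M 2^(kdM)),
   where t is the number of exposed scales among the first M. A scale at which x
   has a hole and is not exposed multiplies mu(B(x, r)) by at most the small
   relative mass e of the holes; by the above lower bound with t = 0 such scales
   have arbitrarily small frequency when e is small. By the pigeonhole principle
   some residue m has frequency of holes at least p, whence the local dimension
   is at most d - p + (log c)/k. Finally 2^-k is comparable to 1 - 2 alpha. *)

Set Implicit Arguments.
Unset Strict Implicit.
Unset Printing Implicit Defensive.

Import Order.TTheory GRing.Theory Num.Theory.
Import numFieldNormedType.Exports.

Local Open Scope classical_set_scope.
Local Open Scope ring_scope.

(** * Euclidean distance and balls *)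

Section EuclideanDistance.
Context {R : realType} {d : nat}.
Implicit Types (x y z : 'rV[R]_d) (r s : R).

Lemma edist_sqr x y : edist x y ^+ 2 = \sum_(i < d) (x ord0 i - y ord0 i) ^+ 2.
Proof. by rewrite /edist sqr_sqrtr// sumr_ge0// => i _; exact: sqr_ge0. Qed.

Lemma edist_ge0 x y : 0 <= edist x y.
Proof. exact: sqrtr_ge0. Qed.

Lemma edistC x y : edist x y = edist y x.
Proof.
by rewrite /edist; congr Num.sqrt; apply: eq_bigr => i _; rewrite -sqrrN opprB.
Qed.

(** Cauchy-Schwarz: the nonnegative sum of the [(B * a i - S * b i) ^+ 2] equals
    [B * (A * B - S ^+ 2)]. *)
Lemma sum_mul_le (I : finType) (a b : I -> R) :
  \sum_i a i * b i <= Num.sqrt (\sum_i a i ^+ 2) * Num.sqrt (\sum_i b i ^+ 2).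
Proof.
set A := \sum_i a i ^+ 2; set B := \sum_i b i ^+ 2; set S := \sum_i _.
have A0 : 0 <= A by apply: sumr_ge0 => i _; exact: sqr_ge0.
have B0 : 0 <= B by apply: sumr_ge0 => i _; exact: sqr_ge0.
have [B1|B1] := eqVneq B 0.
  suff -> : S = 0 by rewrite mulr_ge0 ?sqrtr_ge0.
  rewrite /S big1// => i _; suff -> : b i = 0 by rewrite mulr0.
  apply/eqP; rewrite -sqrf_eq0; move/psumr_eq0P : B1 => -> // j _.
  exact: sqr_ge0.
have Bp : 0 < B by rewrite lt_neqAle eq_sym B1.
have : 0 <= \sum_i (B * a i - S * b i) ^+ 2.
  by apply: sumr_ge0 => i _; exact: sqr_ge0.
have -> : \sum_i (B * a i - S * b i) ^+ 2 = B * (A * B - S ^+ 2).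
  transitivity (\sum_i (B ^+ 2 * a i ^+ 2 + (- 2 * B * S) * (a i * b i)
                        + S ^+ 2 * b i ^+ 2)).
    by apply: eq_bigr => i _; ring.
  rewrite !big_split/= -!mulr_sumr -/A -/B -/S; ring.
rewrite pmulr_rge0// subr_ge0 => h.
rewrite -sqrtrM//; apply: le_trans (ler_norm _) _.
by rewrite -sqrtr_sqr ler_wsqrtr.
Qed.

Lemma edist_triangle y x z : edist x z <= edist x y + edist y z.
Proof.
rewrite -(@ler_pXn2r _ 2)// ?nnegrE ?addr_ge0 ?edist_ge0// sqrrD.
rewrite !edist_sqr.
have := @sum_mul_le _ (fun i => x ord0 i - y ord0 i) (fun i => y ord0 i - z ord0 i).
rewrite -/(edist x y) -/(edist y z) => h.
have -> : \sum_(i < d) (x ord0 i - z ord0 i) ^+ 2 =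
  \sum_(i < d) (x ord0 i - y ord0 i) ^+ 2
  + (\sum_(i < d) (x ord0 i - y ord0 i) * (y ord0 i - z ord0 i)) *+ 2
  + \sum_(i < d) (y ord0 i - z ord0 i) ^+ 2.
  rewrite -sumrMnl -!big_split/=; apply: eq_bigr => i _; ring.
by rewrite lerD2r lerD2l lerMn2r/= h.
Qed.

Lemma coord_le_edist x y i : `|x ord0 i - y ord0 i| <= edist x y.
Proof.
rewrite -sqrtr_sqr /edist ler_wsqrtr// (bigD1 i)//= lerDl.
by apply: sumr_ge0 => j _; exact: sqr_ge0.
Qed.

Lemma edist_le_coord x y s : (forall i, `|x ord0 i - y ord0 i| <= s) ->
  edist x y <= d%:R * s.
Proof.
move=> h; have [d0|d0] := posnP d.
  rewrite /edist big1 ?sqrtr0 ?d0 ?mul0r// => -[j jd].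
  by exfalso; rewrite d0 in jd.
have s0 : 0 <= s by apply: le_trans (h (Ordinal d0)).
rewrite -(@ler_pXn2r _ 2)// ?nnegrE ?edist_ge0// ?mulr_ge0// edist_sqr.
apply: (@le_trans _ _ (\sum_(i < d) s ^+ 2)).
  apply: ler_sum => i _; rewrite -real_normK ?num_real//.
  by rewrite ler_pXn2r// nnegrE.
rewrite sumr_const card_ord exprMn -[leLHS]mulr_natl ler_wpM2r ?sqr_ge0//.
by rewrite -natrX ler_nat; nia.
Qed.

(* [d] is a crude substitute for [sqrt d]. *)
Lemma edist_coord_ge x y s : (0 < d)%N -> s * d%:R < edist x y ->
  exists i, s < `|x ord0 i - y ord0 i|.
Proof.
move=> d0 h; apply: contrapT => hn; move: h; apply/negP; rewrite -leNgt mulrC.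
by apply: edist_le_coord => i; rewrite leNgt; apply/negP => hi; apply: hn; exists i.
Qed.

Lemma cball_subset x z r s : edist x z + s <= r -> cball z s `<=` cball x r.
Proof.
move=> h y /= yz; apply: le_trans (edist_triangle z _ _) _.
by apply: le_trans h; rewrite lerD2l.
Qed.

Lemma le_cball x r s : r <= s -> cball x r `<=` cball x s.
Proof. by move=> rs y /= /le_trans; exact. Qed.

(** Prolong the segment from [x] to [z] beyond [z] by the length [s]: its endpoint lies in the small
    ball and at distance [edist x z + s] from [x]. The hypothesis [s <= r] settles the case of equal
    centres. *)
Lemma cball_subset_dist x z r s : 0 <= s -> s <= r ->
  cball z s `<=` cball x r -> edist x z <= r - s.
Proof.
move=> s0 sr h; have [->|n0] := eqVneq (edist x z) 0; first by rewrite subr_ge0.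
have np : 0 < edist x z by rewrite lt_neqAle eq_sym n0 edist_ge0.
set t := s / edist x z.
have t0 : 0 <= t by rewrite divr_ge0 ?edist_ge0.
have := h (z + t *: (z - x)); rewrite /cball/=.
have -> : edist z (z + t *: (z - x)) = t * edist x z.
  rewrite /edist -[X in X * _](ger0_norm t0) -sqrtr_sqr -sqrtrM ?sqr_ge0//.
  by rewrite mulr_sumr; congr Num.sqrt; apply: eq_bigr => i _; rewrite !mxE; ring.
have -> : edist x (z + t *: (z - x)) = (1 + t) * edist x z.
  have t1 : 0 <= 1 + t by rewrite addr_ge0.
  rewrite /edist -[X in X * _](ger0_norm t1) -sqrtr_sqr -sqrtrM ?sqr_ge0//.
  by rewrite mulr_sumr; congr Num.sqrt; apply: eq_bigr => i _; rewrite !mxE; ring.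
rewrite mulrDl mul1r /t divfK// => /(_ (lexx _)); lra.
Qed.

End EuclideanDistance.

Section Measurability.
Context {R : realType} {d : nat}.
Implicit Types (x y z : 'rV[R]_d) (r s : R).

Lemma edist_continuous x : continuous (edist x : 'rV[R]_d -> R).
Proof.
have sumc : continuous
    (fun y : 'rV[R]_d => \sum_(i < d) (x ord0 i - y ord0 i) ^+ 2).
  apply: continuous_big => [|i _ y]; first exact: add_continuous.
  apply: (@continuous_comp _ _ _ (fun y : 'rV[R]_d => x ord0 i - y ord0 i)
    (fun t : R => t ^+ 2)); last exact: exprn_continuous.
  apply: (@cvgB _ _ _ _ (nbhs_filter y)); first exact: cvg_cst.
  exact: coord_continuous.
by move=> y; apply: continuous_comp; [exact: sumc|exact: sqrt_continuous].
Qed.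

Lemma closed_cball x r : closed (cball x r).
Proof.
have -> : cball x r = edist x @^-1` [set t | t <= r] by [].
move/continuous_closedP : (@edist_continuous x); apply.
exact: closed_le.
Qed.

Lemma compact_cball x r : compact (cball x r).
Proof.
apply: (@subclosed_compact _ _ [set v : 'rV[R]_d |
  forall i, `[x ord0 i - r, x ord0 i + r]%classic (v ord0 i)]).
- exact: closed_cball.
- apply: (@rV_compact _ _ (fun i => `[x ord0 i - r, x ord0 i + r]%classic)) => i.
  exact: segment_compact.
move=> y /= yr i; have := le_trans (coord_le_edist x y i) yr.
by rewrite in_itv/= ler_norml => /andP[h1 h2]; apply/andP; split; lra.
Qed.

Lemma measurable_cball x r : measurable (cball x r : set (borelRd R d)).
Proof.
rewrite -[X in measurable X]setCK; apply: measurableC.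
apply: sub_sigma_algebra.
by rewrite openC; exact: closed_cball.
Qed.

End Measurability.

(** * Points at the boundary of half-size holes *)

Section Columns.
Context {R : realType} {d : nat}.
Implicit Types (x y z : 'rV[R]_d) (r dl t : R).

(* Moving from [x] towards the centre [z] of an almost half-size hole decreases
   the distance to [z] at a definite rate, so a point [y] of the same column
   which is still outside the hole has to be close to [x]. *)
Lemma column_gap x y z (r dl s t : R) (i : 'I_d) :
  (0 < d)%N -> 0 < r -> 0 < dl -> dl <= 16^-1 -> s ^+ 2 = 1 ->
  edist x z <= (2^-1 + dl) * r -> (2^-1 - 3 * dl) * r < edist y z ->
  r / (4 * d%:R) <= s * (z ord0 i - x ord0 i) ->
  (forall c, c != i -> `|y ord0 c - x ord0 c| <= dl * r / (4 * d%:R)) ->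
  y ord0 i - x ord0 i = s * t -> 0 <= t -> t <= r / (4 * d%:R) ->
  t <= 20 * d%:R * dl * r.
Proof.
move=> d0 r0 dl0 dl1 s2 xz yz wi offi yx t0 tr.
have dR : 1 <= d%:R :> R by rewrite ler1n.
set D : R := 4 * d%:R; have D4 : 4 <= D by rewrite /D; lra.
have Dp : 0 < D by lra.
set eta := dl * r / D.
have eta0 : 0 <= eta by rewrite /eta !mulr_ge0 ?invr_ge0; lra.
have etar : eta <= r.
  rewrite /eta ler_pdivrMr//; apply: (@le_trans _ _ (1 * r)).
    by rewrite ler_pM2r//; lra.
  rewrite mulrC ler_pM2l//; lra.
(* Along the axis [i] the squared distance to [z] drops by at least [t * r / D], since both [t] and
   [r / D] are at most [w]. Every other coordinate raises it by at most [3 * eta * r]. *)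
have step c : (y ord0 c - z ord0 c) ^+ 2 <=
    (x ord0 c - z ord0 c) ^+ 2 + 3 * eta * r - (c == i)%:R * (t * r / D).
  have [->|ci] := eqVneq c i.
    rewrite mul1r.
    have -> : y ord0 i - z ord0 i = (x ord0 i - z ord0 i) + s * t by rewrite -yx; ring.
    set w := s * (z ord0 i - x ord0 i) in wi.
    have -> : (x ord0 i - z ord0 i + s * t) ^+ 2 =
      (x ord0 i - z ord0 i) ^+ 2 - 2 * t * w + s ^+ 2 * t ^+ 2 by rewrite /w; ring.
    rewrite s2 mul1r -mulrA.
    have h1 : t * (r / D) <= t * w by rewrite ler_wpM2l.
    have h2 : t ^+ 2 <= t * w by rewrite expr2 ler_wpM2l// (le_trans tr).
    have h3 : 0 <= 3 * eta * r.
      by rewrite -mulrA; apply: mulr_ge0; [lra|exact: mulr_ge0 eta0 (ltW r0)].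
    by lra.
  rewrite mul0r subr0.
  have hy := offi c ci; rewrite -/D -/eta in hy.
  have hx : `|x ord0 c - z ord0 c| <= r.
    apply: le_trans (coord_le_edist x z c) (le_trans xz _).
    by rewrite -[leRHS]mul1r ler_pM2r//; lra.
  have -> : y ord0 c - z ord0 c = (x ord0 c - z ord0 c) + (y ord0 c - x ord0 c) by ring.
  set a := x ord0 c - z ord0 c in hx *; set b := y ord0 c - x ord0 c in hy *.
  have h1 : a * b <= r * eta.
    by apply: le_trans (ler_norm _) _; rewrite normrM ler_pM.
  have h2 : b ^+ 2 <= eta * r.
    rewrite -real_normK ?num_real// expr2; apply: ler_pM => //.
    by lra.
  have -> : 3 * eta * r = r * eta + r * eta + eta * r by ring.
  by rewrite sqrrD mulr2n; lra.
have : edist y z ^+ 2 <= edist x z ^+ 2 + d%:R * (3 * eta * r) - t * r / D.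
  rewrite !edist_sqr.
  apply: le_trans; first by apply: ler_sum => c _; exact: step.
  rewrite sumrB big_split/= sumr_const card_ord -[X in _ + X - _]mulr_natl.
  rewrite lerB// (bigD1 i)//= eqxx mul1r big1 ?addr0//.
  by move=> c /negPf ->; rewrite mul0r.
have -> : d%:R * (3 * eta * r) = (3/4) * dl * r ^+ 2.
  rewrite /eta /D; field; lra.
have h1 : edist x z ^+ 2 <= ((2^-1 + dl) * r) ^+ 2.
  by rewrite ler_pXn2r ?nnegrE ?edist_ge0// mulr_ge0//; lra.
have h2 : ((2^-1 - 3 * dl) * r) ^+ 2 <= edist y z ^+ 2.
  by rewrite ler_pXn2r ?nnegrE ?edist_ge0// ?mulr_ge0//; lra.
move=> h3.
(* The squared radii differ by [(4 * dl - 8 * dl ^+ 2) * r ^+ 2], and the other coordinates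
   contribute [3 / 4 * dl * r ^+ 2]. *)
have h4 : t * r / D <= 5 * dl * r ^+ 2.
  have h5 : 0 <= dl ^+ 2 * r ^+ 2 by rewrite mulr_ge0 ?sqr_ge0.
  have h6 : 0 <= dl * r ^+ 2 by rewrite mulr_ge0 ?sqr_ge0// ltW.
  have : t * r / D <= ((2^-1 + dl) * r) ^+ 2 - ((2^-1 - 3 * dl) * r) ^+ 2
      + 3 / 4 * dl * r ^+ 2.
    lra.
  have -> : ((2^-1 + dl) * r) ^+ 2 - ((2^-1 - 3 * dl) * r) ^+ 2
      + 3 / 4 * dl * r ^+ 2
     = (19/4) * (dl * r ^+ 2) - 8 * (dl ^+ 2 * r ^+ 2) by field.
  by move=> h7; rewrite -[5 * dl * _]mulrA; lra.
rewrite ler_pdivrMr// in h4.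
rewrite -(ler_pM2r r0); apply: le_trans h4 _.
by rewrite /D le_eqVlt; apply/orP; left; apply/eqP; ring.
Qed.

End Columns.

(** * Grid cells and their subdivision *)

Section Cells.
Context {R : realType} {d : nat}.
Implicit Types (x y z : 'rV[R]_d).

(* Cells of side [2 ^- j / (4 * d)], hence of diameter at most [2 ^- j / 4]. *)
Definition cell x (j : nat) : {ffun 'I_d -> int} :=
  [ffun i => Num.floor (x ord0 i * (4 * d * 2 ^ j)%:R)].

Definition child (K : nat) (q : {ffun 'I_d -> int}) (f : {ffun 'I_d -> 'I_K}) :
    {ffun 'I_d -> int} :=
  [ffun i => q i * K%:Z + (f i : nat)%:Z].

Lemma floor_sub_lt (a b : R) : (Num.floor a - Num.floor b)%:~R < a - b + 1.
Proof.
rewrite intrB; have /andP[h1 h2] := floor_itv a; have /andP[h3 h4] := floor_itv b.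
rewrite !intrD1 in h2 h4; lra.
Qed.

Lemma cell_coord (x y : 'rV[R]_d) j i : (0 < d)%N -> cell x j i = cell y j i ->
  `|x ord0 i - y ord0 i| <= 2 ^- j / (4 * d%:R).
Proof.
move=> d0; rewrite !ffunE => h.
set N : R := (4 * d * 2 ^ j)%:R.
have N0 : 0 < N by rewrite ltr0n !muln_gt0 d0 expn_gt0.
have -> : 2 ^- j / (4 * d%:R) = N^-1 :> R.
  by rewrite /N !natrM natrX !invfM mulrC.
rewrite -[leRHS]mul1r ler_pdivlMr// -[X in _ * X](gtr0_norm N0) -normrM mulrBl.
have h1 := floor_sub_lt (x ord0 i * N) (y ord0 i * N).
have h2 := floor_sub_lt (y ord0 i * N) (x ord0 i * N).
rewrite h subrr in h1; rewrite h subrr in h2.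
by rewrite ler_norml; apply/andP; split; lra.
Qed.

Lemma cell_edist (x y : 'rV[R]_d) j : (0 < d)%N -> cell x j = cell y j ->
  edist x y <= 2 ^- j / 4.
Proof.
move=> d0 h.
have dR : 1 <= d%:R :> R by rewrite ler1n.
apply: le_trans (@edist_le_coord _ _ _ _ (2 ^- j / (4 * d%:R)) _) _.
  by move=> i; apply: cell_coord; rewrite // h.
rewrite le_eqVlt; apply/orP; left; apply/eqP; field.
by rewrite expf_neq0//= gt_eqF//; lra.
Qed.

(** With [N = 2 ^ k], the floor of [a * N] is at least [N] times the floor of [a] and exceeds it by
    less than [N]; the excess is the entry of [f]. *)
Lemma cell_child x j k : exists f : {ffun 'I_d -> 'I_(2 ^ k)},
  cell x (j + k) = child (cell x j) f.
Proof.
have h i : exists u : 'I_(2 ^ k),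
    cell x (j + k) i = cell x j i * (2 ^ k)%N%:Z + (u : nat)%:Z.
  rewrite !ffunE expnD mulnA natrM mulrA.
  set a := x ord0 i * _; set N := (2 ^ k)%N.
  have N0 : (0 < N)%N by rewrite expn_gt0.
  have NR : 0 < N%:R :> R by rewrite ltr0n.
  have /andP[h1 h2] := floor_itv a.
  have l1 : Num.floor a * N%:Z <= Num.floor (a * N%:R).
    by rewrite floor_ge_int intrM ler_pM2r.
  have l2 : Num.floor (a * N%:R) < Num.floor a * N%:Z + N%:Z.
    rewrite floor_lt_int intrD intrM -[X in _ + X]mul1r -mulrDl ltr_pM2r//.
    by move: h2; rewrite intrD.
  have hu : (`|(Num.floor (a * N%:R) - Num.floor a * N%:Z)%R|%N < N)%N by lia.
  exists (Ordinal hu) => /=; lia.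
have [u hu] := choice h.
by exists (finfun u); apply/ffunP => i; rewrite hu !ffunE.
Qed.

End Cells.

(** * Few subcells meet the exposed points *)

Definition column_width (d : nat) : nat := 80 * d ^ 2 + 1.
(** There are [2 * d] signed axes. The gap [20 * d * 2 ^- k * 2 ^- j] of [column_gap] measures
    [80 * d ^ 2] subcells of side [2 ^- (j + k) / (4 * d)], and rounding adds one; this is
    [column_width d]. *)
Definition exposed_const (d : nat) : nat := 2 * d * column_width d.

Lemma exposed_const_gt0 (d : nat) : (0 < d)%N -> (0 < exposed_const d)%N.
Proof.
by move=> d0; rewrite /exposed_const /column_width !muln_gt0 d0 addn1.
Qed.

Lemma eqn_mod_close (a b c : nat) :
  `|a%:Z - b%:Z| < c%:Z -> a = b %[mod c] -> a = b.
Proof.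
wlog le_ab : a b / (b <= a)%N => [hw h e|h /eqP].
  by case/orP: (leq_total b a) => ?; [|symmetry]; apply: hw => //; rewrite distrC.
rewrite eqn_mod_dvd// => /dvdnP[[|m] hm]; nia.
Qed.

Lemma invr_exp2_le (R : realType) (k : nat) : (4 <= k)%N ->
  0 < 2 ^- k :> R /\ 2 ^- k <= 16^-1 :> R.
Proof.
move=> k4; split; first by rewrite invr_gt0 exprn_gt0.
rewrite lef_pV2 ?posrE ?exprn_gt0//.
by rewrite -natrX ler_nat -[16%N]/(2 ^ 4)%N leq_exp2l.
Qed.

Section ExposedPoints.
Context {R : realType} {d : nat}.
Implicit Types (x y z : 'rV[R]_d) (P : 'rV[R]_d -> 'rV[R]_d -> Prop).

(* [P x z] stands for "[z] is the centre of a hole of relative size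
   [2^-1 - dl] in the ball of radius [2 ^- j] around [x]". *)
Definition exposed P (dl : R) (j : nat) x : Prop :=
  (exists z, P x z) /\
  ~ exists y z, [/\ cell y j = cell x j, P y z &
                    edist x z <= (2^-1 - 3 * dl) * 2 ^- j].


(** Taking [y = x] in the definition of exposure puts [z] further than
    [(2^-1 - 3 * 2 ^- k) * 2 ^- j] from [x]. As [2 ^- k <= 16^-1], this is more than a quarter of
    the scale, so some coordinate differs by the stated amount. *)
Lemma exposed_axis P (k j : nat) x : (0 < d)%N -> (4 <= k)%N ->
  exposed P (2 ^- k) j x -> exists z (i : 'I_d) (s : bool), P x z /\
    2 ^- j / (4 * d%:R) <= (-1) ^+ s * (z ord0 i - x ord0 i).
Proof.
move=> d0 k4 [[z Pz] nz].
have [dl0 k16] := invr_exp2_le R k4.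
have dR : 1 <= d%:R :> R by rewrite ler1n.
have r0 : 0 < 2 ^- j :> R by rewrite invr_gt0 exprn_gt0.
have xz : 2 ^- j / (4 * d%:R) * d%:R < edist x z.
  rewrite ltNge; apply/negP => h; apply: nz; exists x, z; split => //.
  apply: le_trans h _.
  have -> : 2 ^- j / (4 * d%:R) * d%:R = 4^-1 * 2 ^- j :> R.
    by field; rewrite expf_neq0//= gt_eqF//; lra.
  by rewrite ler_pM2r//; lra.
have [i hi] := edist_coord_ge d0 xz.
exists z, i, (z ord0 i - x ord0 i < 0); split => //.
rewrite distrC in hi; apply: ltW; apply: lt_le_trans hi _.
case: ltP => h; first by rewrite expr1 mulN1r ltr0_norm.
by rewrite expr0 mul1r ger0_norm.
Qed.

(** The point [x] shares the cell of [y], so exposure of [y] keeps [y] out of the shrunken hole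
    around [z], although [y] is reached from [x] by moving towards [z]. Then [column_gap] bounds the
    displacement, which is converted into a number of subcells. *)
Lemma exposed_column P (k j : nat) x y z (i : 'I_d) (s : bool) :
  (0 < d)%N -> (4 <= k)%N ->
  (forall x z, P x z -> edist x z <= (2^-1 + 2 ^- k) * 2 ^- j) ->
  exposed P (2 ^- k) j y -> cell x j = cell y j -> P x z ->
  2 ^- j / (4 * d%:R) <= (-1) ^+ s * (z ord0 i - x ord0 i) ->
  (forall c, c != i -> cell x (j + k) c = cell y (j + k) c) ->
  0 <= (-1) ^+ s * (y ord0 i - x ord0 i) ->
  `|cell y (j + k) i - cell x (j + k) i| < (column_width d)%:Z.
Proof.
move=> d0 k4 Pr [_ ny] xy Pxz zi off yi.
have [dl0 k16] := invr_exp2_le R k4.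
have s2 : ((-1) ^+ s) ^+ 2 = 1 :> R by rewrite sqrr_sign.
have dR : 1 <= d%:R :> R by rewrite ler1n.
have r0 : 0 < 2 ^- j :> R by rewrite invr_gt0 exprn_gt0.
set t := (-1) ^+ s * (y ord0 i - x ord0 i) in yi.
have yxt : y ord0 i - x ord0 i = (-1) ^+ s * t.
  by rewrite /t mulrA -expr2 s2 mul1r.
have tn : t = `|y ord0 i - x ord0 i|.
  by rewrite -[LHS](ger0_norm yi) /t normrM normr_sign mul1r.
have ht : t <= 20 * d%:R * 2 ^- k * 2 ^- j.
  apply: (@column_gap _ _ x y z _ _ ((-1) ^+ s) _ i) => //.
  - exact: Pr.
  - rewrite ltNge; apply/negP => h; apply: ny; exists x, z; split => //.
  - move=> c ci; rewrite -invfM -exprD addnC distrC.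
    by apply: cell_coord => //; exact: off.
  - rewrite tn distrC; apply: cell_coord => //.
    exact: (congr1 (fun q : {ffun 'I_d -> int} => q i) xy).
have N0 : 0 < (4 * d * 2 ^ (j + k))%:R :> R.
  by rewrite ltr0n !muln_gt0 d0 expn_gt0.
have tN : `|y ord0 i - x ord0 i| * (4 * d * 2 ^ (j + k))%:R <= (80 * d ^ 2)%:R.
  rewrite -tn; apply: le_trans (ler_wpM2r (ltW N0) ht) _.
  rewrite !natrM !natrX exprD le_eqVlt; apply/orP; left; apply/eqP; field.
  by rewrite !expf_neq0.
rewrite -(@ltr_int R) -pmulrn /column_width natrD intr_norm ltr_norml.
rewrite !ffunE.
set a := y ord0 i * _; set b := x ord0 i * _.
have : `|a - b| <= (80 * d ^ 2)%:R by rewrite /a /b -mulrBl normrM (gtr0_norm N0).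
rewrite ler_norml => /andP[h1 h2].
have h3 := floor_sub_lt a b; have h4 := floor_sub_lt b a.
rewrite -opprB mulrNz in h4.
by apply/andP; split; lra.
Qed.

(* The map sending [(f, u)] to the axis and sign attached to [f], to [f] with
   the entry along this axis replaced by [u], and to this entry modulo the
   column width, is injective. *)
Lemma exposed_children P (k j : nat) (q : {ffun 'I_d -> int}) :
  (0 < d)%N -> (4 <= k)%N ->
  (forall x z, P x z -> edist x z <= (2^-1 + 2 ^- k) * 2 ^- j) ->
  exists2 T : {set {ffun 'I_d -> 'I_(2 ^ k)}},
    (#|T| * 2 ^ k <= exposed_const d * 2 ^ (k * d))%N &
    forall x, cell x j = q -> exposed P (2 ^- k) j x ->
      exists2 f, f \in T & cell x (j + k) = child q f.
Proof.
move=> d0 k4 Pr.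
pose E (f : {ffun 'I_d -> 'I_(2 ^ k)})
    (w : 'rV[R]_d * 'rV[R]_d * ('I_d * bool)) :=
  [/\ cell w.1.1 j = q, exposed P (2 ^- k) j w.1.1,
      cell w.1.1 (j + k) = child q f, P w.1.1 w.1.2 &
      2 ^- j / (4 * d%:R) <=
      (-1) ^+ w.2.2 * (w.1.2 ord0 w.2.1 - w.1.1 ord0 w.2.1)].
pose T := [set f | `[< exists w, E f w >]]%SET.
have /choice[w wP] f : exists w, f \in T -> E f w.
  have [|fT] := boolP (f \in T); last by exists (0, 0, (Ordinal d0, false)).
  by rewrite inE => /asboolP[w Ew]; exists w.
exists T; last first.
  move=> x xq ex; have [z [i [s [Pz zi]]]] := exposed_axis d0 k4 ex.
  have [f fP] := cell_child x j k.
  exists f; last by rewrite fP xq.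
  by rewrite inE; apply/asboolP; exists (x, z, (i, s)); split => //=; rewrite fP xq.
have C0 : (0 < column_width d)%N by rewrite /column_width addn1.
pose g (v : {ffun 'I_d -> 'I_(2 ^ k)} * 'I_(2 ^ k)) :
    ('I_d * bool) * ({ffun 'I_d -> 'I_(2 ^ k)} * 'I_(column_width d)) :=
  ((w v.1).2, ([ffun c => if c == (w v.1).2.1 then v.2 else v.1 c],
     Ordinal (ltn_pmod (v.1 (w v.1).2.1) C0))).
have ginj : {in finset.setX T [set: 'I_(2 ^ k)]%SET &, injective g}.
  move=> [f u] [f' u']; rewrite !inE !andbT /= => fT f'T [] wE offE modE.
  have [xq ex xf Pxz zi] : E f (w f) by apply: wP; rewrite inE.
  have [xq' ex' xf' Pxz' zi'] : E f' (w f') by apply: wP; rewrite inE.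
  rewrite -wE in offE modE zi'.
  set i := (w f).2.1 in offE modE zi zi'.
  have uE : u = u' by move/ffunP : offE => /(_ i); rewrite !ffunE eqxx.
  have off c : c != i -> f c = f' c.
    by move=> ci; move/ffunP : offE => /(_ c); rewrite !ffunE (negPf ci).
  have cE c : c != i -> cell (w f).1.1 (j + k) c = cell (w f').1.1 (j + k) c.
    by move=> ci; rewrite xf xf' !ffunE off.
  have lt_col : (`|(f i)%:Z - (f' i)%:Z| < (column_width d)%:Z).
    have -> : `|(f i)%:Z - (f' i)%:Z| =
        `|cell (w f).1.1 (j + k) i - cell (w f').1.1 (j + k) i|.
      by rewrite xf xf' !ffunE; congr `|_|; ring.
    set y := (w f).1.1 in xq ex xf Pxz zi cE *.
    set y' := (w f').1.1 in xq' ex' xf' Pxz' zi' cE *.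
    (* Both points have the same signed axis. The one further along it plays the exposed point, the
       other one supplies the hole. *)
    have [le0|lt0] := leP 0 ((-1) ^+ (w f).2.2 * (y ord0 i - y' ord0 i)).
      apply: (exposed_column d0 k4 Pr ex _ Pxz' zi') => //; first by rewrite xq.
      by move=> c /cE.
    rewrite distrC.
    apply: (exposed_column d0 k4 Pr ex' _ Pxz zi) => //; first by rewrite xq.
    by rewrite -opprB mulrN; lra.
  suff -> : f = f' by rewrite uE.
  apply/ffunP => c; have [->|/off//] := eqVneq c i.
  apply: val_inj => /=.
  by apply: (eqn_mod_close lt_col); case: modE.
have := card_in_imset ginj; rewrite cardsX cardsT card_ord => <-.
apply: leq_trans (max_card _) _.
rewrite !card_prod card_ffun !card_ord card_bool -expnM mulnC /exposed_const.
by rewrite mulnCA mulnC [(2 * d)%N]mulnC; nia.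
Qed.

End ExposedPoints.

(** * Counting cells and the Borel-Cantelli argument *)

Lemma count_iotaS (p : pred nat) (n : nat) :
  count p (iota 0 n.+1) = (count p (iota 0 n) + p n)%N.
Proof. by rewrite -addn1 iotaD count_cat /= add0n addn0. Qed.

Section ExposedCover.
Context {R : realType} {d : nat}.
Implicit Types (x : 'rV[R]_d) (P : nat -> 'rV[R]_d -> 'rV[R]_d -> Prop).

Definition exposed_count P (k m M : nat) x : nat :=
  count (fun l => `[< exposed (P l) (2 ^- k) (m + l * k) x >]) (iota 0 M).

Lemma exposed_countS P k m M x : exposed_count P k m M.+1 x =
  (exposed_count P k m M x + `[< exposed (P M) (2 ^- k) (m + M * k) x >])%N.
Proof. exact: count_iotaS. Qed.

Lemma size_allpairs_le (A B C : eqType) (f : A -> B -> C) (s : seq A)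
    (t : A -> seq B) (K N : nat) : (forall a, (size (t a) * K <= N)%N) ->
  (size [seq f a b | a <- s, b <- t a] * K <= size s * N)%N.
Proof.
move=> h; rewrite size_allpairs_dep; elim: s => //= a s ih.
by rewrite mulnDl mulSn leq_add.
Qed.

(** Induction on the number of scales. If the last scale is not exposed, all [2 ^ (k * d)] children
    are kept; if it is, only those from [exposed_children], which saves a factor [2 ^ k] up to
    [exposed_const d]. The factor 2 pays for adding the two lists. *)
Lemma exposed_cover P k m (q0 : {ffun 'I_d -> int}) M t :
  (0 < d)%N -> (4 <= k)%N ->
  (forall l x z, P l x z -> edist x z <= (2^-1 + 2 ^- k) * 2 ^- (m + l * k)) ->
  exists2 s : seq {ffun 'I_d -> int},
    (size s * 2 ^ (k * t) <= (2 * exposed_const d) ^ M * 2 ^ (k * d * M))%N &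
    forall x, cell x m = q0 -> exposed_count P k m M x = t ->
      cell x (m + M * k) \in s.
Proof.
move=> d0 k4 Pr; elim: M t => [|M IH] t.
  exists (if t is 0%N then [:: q0] else [::]); first by case: t; rewrite ?muln0.
  by move=> x <- <- /=; rewrite mul0n addn0 mem_head.
have /choice[T TP] (q : {ffun 'I_d -> int}) :
    exists T : {set {ffun 'I_d -> 'I_(2 ^ k)}},
    (#|T| * 2 ^ k <= exposed_const d * 2 ^ (k * d))%N /\
    forall x, cell x (m + M * k) = q -> exposed (P M) (2 ^- k) (m + M * k) x ->
      exists2 f, f \in T & cell x (m + M * k + k) = child q f.
  by have [T T1 T2] := exposed_children q d0 k4 (Pr M); exists T.
have C0 := exposed_const_gt0 d0.
have [s s_size s_mem] := IH t.
(* The list [s'] serves the points exposed at the last scale, with [t - 1] exposed scales before it;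
   for [t = 0] there are none. *)
have [s' s'_size s'_mem] : exists2 s' : seq {ffun 'I_d -> int},
    (size s' * 2 ^ (k * t) <=
     (2 * exposed_const d) ^ M * 2 ^ (k * d * M) * 2 ^ k)%N &
    forall x, cell x m = q0 -> (exposed_count P k m M x).+1 = t ->
      cell x (m + M * k) \in s'.
  case: t {s s_size s_mem} => [|t]; first by exists [::].
  have [s s_size s_mem] := IH t.
  exists s; last by move=> x ? [?]; exact: s_mem.
  by rewrite mulnS expnD mulnCA mulnC leq_mul2r s_size orbT.
set A := [seq child q f | q <- s, f <- enum {ffun 'I_d -> 'I_(2 ^ k)}].
set A' := [seq child q f | q <- s', f <- enum (T q)].
exists (A ++ A').
  have hA : (size A * 1 <= size s * 2 ^ (k * d))%N.
    apply: size_allpairs_le => q.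
    by rewrite muln1 -cardE card_ffun !card_ord -expnM.
  have hA' : (size A' * 2 ^ k <= size s' * (exposed_const d * 2 ^ (k * d)))%N.
    by apply: size_allpairs_le => q; rewrite -cardE (TP q).1.
  rewrite size_cat mulnDl expnS mulnS expnD.
  set B := ((2 * exposed_const d) ^ M * 2 ^ (k * d * M))%N in s_size s'_size.
  have h1 : (size A * 2 ^ (k * t) <= B * 2 ^ (k * d))%N.
    rewrite muln1 in hA; apply: leq_trans (leq_mul hA (leqnn _)) _.
    by rewrite mulnAC leq_mul2r s_size orbT.
  have h2 : (size A' * 2 ^ (k * t) <= B * (exposed_const d * 2 ^ (k * d)))%N.
    rewrite -(@leq_pmul2r (2 ^ k)) ?expn_gt0// mulnAC.
    apply: leq_trans (leq_mul hA' (leqnn _)) _.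
    by rewrite mulnAC [leqRHS]mulnAC leq_mul2r s'_size orbT.
  have -> : (2 * exposed_const d * (2 * exposed_const d) ^ M *
      (2 ^ (k * d) * 2 ^ (k * d * M)) =
      B * (2 * exposed_const d * 2 ^ (k * d)))%N by rewrite /B; ring.
  apply: leq_trans (leq_add h1 h2) _.
  rewrite -mulnDr leq_mul2l -mulnA mul2n -addnn leq_add2r.
  by rewrite leq_pmull ?orbT.
move=> x xm; rewrite exposed_countS mem_cat mulSn [(k + _)%N]addnC addnA.
case: asboolP => ex xt; apply/orP; [right|left].
  have [f fT ->] := (TP _).2 x erefl ex.
  apply/allpairsPdep; exists (cell x (m + M * k)), f; split => //.
    by apply: s'_mem => //; rewrite -addn1.
  by rewrite mem_enum.
have [f ->] := cell_child x (m + M * k) k.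
apply/allpairsPdep; exists (cell x (m + M * k)), f; split => //.
  by apply: s_mem => //; rewrite -xt addn0.
by rewrite mem_enum.
Qed.

End ExposedCover.

(** * Borel-Cantelli for light cells *)

Lemma measure_bigU_le (disp : measure_display) (T : measurableType disp)
    (R : realType) (mu : {measure set T -> \bar R}) (I : Type) (r : seq I)
    (P : pred I) (F : I -> set T) : (forall i, measurable (F i)) ->
  (mu (\big[setU/set0]_(i <- r | P i) F i) <= \sum_(i <- r | P i) mu (F i))%E.
Proof.
move=> mF; elim: r => [|i r IH]; first by rewrite !big_nil measure0.
rewrite !big_cons; case: ifP => // Pi.
apply: le_trans; last exact: (leeD2l _ IH).
by apply: measureU2 => //; exact: bigsetU_measurable.
Qed.

Lemma mem_bigsetU (T : Type) (I : eqType) (r : seq I) (P : pred I)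
    (F : I -> set T) i x : i \in r -> P i -> F i x ->
  (\big[setU/set0]_(j <- r | P j) F j) x.
Proof.
move=> ir Pi Fx; rewrite big_mkcond (perm_big _ (perm_to_rem ir)) big_cons Pi.
by left.
Qed.

(** The threshold below which a cell counts as light: as [8 = 2 * 4], its product with the number of
    cells allowed by [exposed_cover] is at most [4 ^- M]. *)
Definition exposed_mass (R : realType) (d k M t : nat) : R :=
  (2 ^ (k * t))%:R / ((8 * exposed_const d) ^ M * 2 ^ (k * d * M))%:R.

Lemma exposed_mass_gt0 (R : realType) (d k M t : nat) :
  (0 < d)%N -> 0 < exposed_mass R d k M t.
Proof.
move=> d0; rewrite divr_gt0// ltr0n ?muln_gt0 !expn_gt0//.
by rewrite muln_gt0 exposed_const_gt0.
Qed.

Section AlmostEverywhere.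
Context {R : realType} {d : nat} (mu : {measure set (borelRd R d) -> \bar R}).
Implicit Types (x : 'rV[R]_d) (P : nat -> 'rV[R]_d -> 'rV[R]_d -> Prop).

(** A measurable substitute for a cell: a ball around one of its points whose radius bounds the
    diameter of the cell. *)
Definition cell_ball (j : nat) (q : {ffun 'I_d -> int}) : set 'rV[R]_d :=
  cball (xget 0 [set x | cell x j = q]) (2 ^- j / 4).

Lemma cell_ball_mem j x : (0 < d)%N -> cell_ball j (cell x j) x.
Proof.
move=> d0; rewrite /cell_ball /cball /=; apply: cell_edist => //.
by apply: (@xgetPex _ 0 [set y | cell y j = cell x j]); exists x.
Qed.

Lemma cell_ball_subset j q x : cell_ball j q x ->
  cell_ball j q `<=` cball x (2 ^- j).
Proof.
rewrite /cell_ball /cball /= => qx y qy.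
apply: le_trans (edist_triangle (xget 0 [set x | cell x j = q]) _ _) _.
rewrite edistC; apply: le_trans (lerD qx qy) _.
have : 0 < 2 ^- j :> R by rewrite invr_gt0 exprn_gt0.
by lra.
Qed.

(** [F M] is the union of the light cell balls over all values of [t]. Its masses are summable, so
    almost every point lies in only finitely many [F M]. Fixing the initial cell [q0] keeps the
    covers finite. *)
Lemma ae_exposed_cell P k m (q0 : {ffun 'I_d -> int}) :
  (0 < d)%N -> (4 <= k)%N ->
  (forall l x z, P l x z -> edist x z <= (2^-1 + 2 ^- k) * 2 ^- (m + l * k)) ->
  exists2 N : set (borelRd R d), mu.-negligible N &
    forall x, ~ N x -> cell x m = q0 ->
      exists M0, forall M, (M0 <= M)%N ->
        ((exposed_mass R d k M (exposed_count P k m M x))%:E <=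
         mu (cball x (2 ^- (m + M * k))))%E.
Proof.
move=> d0 k4 Pr.
have /choice[s sP] (Mt : nat * nat) : exists s : seq {ffun 'I_d -> int},
    (size s * 2 ^ (k * Mt.2) <=
     (2 * exposed_const d) ^ Mt.1 * 2 ^ (k * d * Mt.1))%N /\
    forall x, cell x m = q0 -> exposed_count P k m Mt.1 x = Mt.2 ->
      cell x (m + Mt.1 * k) \in s.
  by have [s s1 s2] := exposed_cover q0 Mt.1 Mt.2 d0 k4 Pr; exists s.
pose light M t q :=
  (mu (cell_ball (m + M * k) q) < (exposed_mass R d k M t)%:E)%E.
pose G M t : set (borelRd R d) :=
  \big[setU/set0]_(q <- s (M, t) | light M t q) cell_ball (m + M * k) q.
pose F M : set (borelRd R d) := \big[setU/set0]_(t < M.+1) G M t.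
have mB j q : measurable (cell_ball j q : set (borelRd R d)).
  exact: measurable_cball.
have mG M t : measurable (G M t) by exact: bigsetU_measurable.
have mF M : measurable (F M) by exact: bigsetU_measurable.
have muG M t : (mu (G M t) <= (4 ^- M)%:E)%E.
  apply: le_trans (measure_bigU_le _ _ _ _) _ => //.
  apply: (@le_trans _ _ (\sum_(q <- s (M, t) | light M t q)
      (exposed_mass R d k M t)%:E)%E).
    by apply: lee_sum => q /ltW.
  rewrite sumEFin lee_fin big_const_seq iter_addr_0.
  apply: (@le_trans _ _ (exposed_mass R d k M t *+ size (s (M, t)))).
    by rewrite ler_wpMn2l ?count_size// ltW// (exposed_mass_gt0 R).
  have C0 := exposed_const_gt0 d0.
  rewrite -[leLHS]mulr_natr /exposed_mass mulrAC ler_pdivrMr; last first.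
    by rewrite ltr0n muln_gt0 !expn_gt0 muln_gt0 C0.
  rewrite mulrC -natrM [leRHS]mulrC ler_pdivlMr ?exprn_gt0//.
  rewrite -natrX -natrM ler_nat.
  apply: leq_trans (leq_mul (sP (M, t)).1 (leqnn _)) _ => /=.
  by rewrite mulnAC -expnMn mulnAC.
(* The [M + 1] values of [t] give [(M + 1) * 4 ^- M <= 2 ^- M], written in the form that
   [epsilon_trick0] sums. *)
have muF M : (mu (F M) <= (2 / (2 ^ M.+1)%:R)%:E)%E.
  apply: le_trans (measure_bigU_le _ _ _ _) _ => //.
  apply: (@le_trans _ _ (\sum_(t < M.+1) (4 ^- M)%:E)%E).
    by apply: lee_sum => t _; exact: muG.
  rewrite sumEFin lee_fin sumr_const card_ord -[leLHS]mulr_natl.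
  rewrite ler_pdivrMr ?exprn_gt0// mulrAC ler_pdivlMr ?ltr0n ?expn_gt0//.
  rewrite -!natrX -!natrM ler_nat expnS mulnCA leq_mul2l/=.
  by rewrite -[4%N]/(2 * 2)%N expnMn leq_mul2r ltn_expl// orbT.
exists (lim_sup_set F).
  exists (lim_sup_set F); split => //.
    apply: bigcapT_measurable => n; exact: bigcup_measurable.
  apply: lim_sup_set_cvg0 => //.
  apply: (@le_lt_trans _ _ 2%:E); last by rewrite ltry.
  apply: le_trans (epsilon_trick0 xpredT _) => //.
  by apply: lee_nneseries => // n _; exact: muF.
move=> x Nx xq.
have [M0 hM0] : exists M0, forall M, (M0 <= M)%N -> ~ F M x.
  apply: contrapT => h; apply: Nx => n _.
  apply: contrapT => h2; apply: h; exists n => M nM FM.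
  by apply: h2; exists M.
exists M0 => M M0M; set t := exposed_count P k m M x.
rewrite leNgt; apply/negP => lt_mass; apply: (hM0 M M0M).
have tM : (t < M.+1)%N by rewrite ltnS -[leqRHS](size_iota 0) count_size.
apply: (@mem_bigsetU _ _ _ _ _ (Ordinal tM)) => //; first exact: mem_index_enum.
apply: (@mem_bigsetU _ _ _ _ _ (cell x (m + M * k))).
- exact: (sP (M, t)).2.
- apply: le_lt_trans lt_mass; rewrite le_measure ?inE//.
    exact: measurable_cball.
  by apply: cell_ball_subset; exact: cell_ball_mem.
- exact: cell_ball_mem.
Qed.

End AlmostEverywhere.

(** * Holes of small mass *)

(** The factor lost per step of [k] scales: its power [M] is [exposed_mass] for [t = 0]. *)
Definition base_mass (R : realType) (d k : nat) : R :=
  (8 * exposed_const d * 2 ^ (k * d))%:R^-1.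

Lemma base_mass_gt0 (R : realType) (d k : nat) :
  (0 < d)%N -> 0 < base_mass R d k.
Proof.
move=> d0; rewrite invr_gt0 ltr0n muln_gt0 expn_gt0 andbT.
by rewrite muln_gt0 exposed_const_gt0.
Qed.

Lemma base_mass_le1 (R : realType) (d k : nat) :
  (0 < d)%N -> base_mass R d k <= 1.
Proof.
move=> d0; have := base_mass_gt0 R k d0; rewrite /base_mass invr_gt0 => h.
by rewrite invf_le1// ler1n -(ltr0n R).
Qed.

Lemma base_mass_le (R : realType) (d k M t : nat) :
  base_mass R d k ^+ M <= exposed_mass R d k M t.
Proof.
rewrite /exposed_mass /base_mass [(2 ^ (k * d * M))%N]expnM -expnMn [X in _ / X]natrX.
rewrite exprVn ler_peMl ?invr_ge0 ?exprn_ge0//.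
by rewrite ler1n expn_gt0.
Qed.

Section Holes.
Context {R : realType} {d : nat} (mu : {measure set (borelRd R d) -> \bar R}).
Implicit Types (x y z : 'rV[R]_d) (P : nat -> 'rV[R]_d -> 'rV[R]_d -> Prop).

(** There are countably many initial cells, so their exceptional sets have a negligible union. *)
Lemma ae_exposed P k m : (0 < d)%N -> (4 <= k)%N ->
  (forall l x z, P l x z -> edist x z <= (2^-1 + 2 ^- k) * 2 ^- (m + l * k)) ->
  exists2 N : set (borelRd R d), mu.-negligible N &
    forall x, ~ N x -> exists M0, forall M, (M0 <= M)%N ->
      ((exposed_mass R d k M (exposed_count P k m M x))%:E <=
       mu (cball x (2 ^- (m + M * k))))%E.
Proof.
move=> d0 k4 Pr.
have /choice[N NP] (q : {ffun 'I_d -> int}) : exists N : set (borelRd R d),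
    mu.-negligible N /\ forall x, ~ N x -> cell x m = q ->
      exists M0, forall M, (M0 <= M)%N ->
        ((exposed_mass R d k M (exposed_count P k m M x))%:E <=
         mu (cball x (2 ^- (m + M * k))))%E.
  by have [N] := ae_exposed_cell mu q d0 k4 Pr; exists N.
exists (\bigcup_n (if unpickle n is Some q then N q else set0)).
  apply: negligible_bigcup => n; case: unpickle => [q|]; last exact: negligible_set0.
  by have [] := NP q.
move=> x Nx; have [_] := NP (cell x m); apply => // Nqx; apply: Nx.
by exists (pickle (cell x m)) => //; rewrite pickleK.
Qed.

(** The relative radius is fixed at [2^-1 - 2 ^- k], so that the geometry depends on [k] only;
    porosity at any larger value provides such a hole. *)
Definition hole (e : R) (k j : nat) x z : Prop :=
  cball z ((2^-1 - 2 ^- k) * 2 ^- j) `<=` cball x (2 ^- j) /\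
  (mu (cball z ((2^-1 - 2 ^- k) * 2 ^- j)) <= e%:E * mu (cball x (2 ^- j)))%E.

Lemma le_mu_cball x y (r s : R) : cball x r `<=` cball y s ->
  (mu (cball x r) <= mu (cball y s))%E.
Proof. by move=> h; rewrite le_measure ?inE//; exact: measurable_cball. Qed.

Lemma hole_dist e k j x z : (4 <= k)%N -> hole e k j x z ->
  edist x z <= (2^-1 + 2 ^- k) * 2 ^- j.
Proof.
move=> k4 [h _]; have [k0 k16] := invr_exp2_le R k4.
have r0 : 0 < 2 ^- j :> R by rewrite invr_gt0 exprn_gt0.
have -> : (2^-1 + 2 ^- k) * 2 ^- j = 2 ^- j - (2^-1 - 2 ^- k) * 2 ^- j :> R by lra.
apply: cball_subset_dist => //; first by rewrite mulr_ge0//; lra.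
by rewrite -[leRHS]mul1r ler_pM2r//; lra.
Qed.

Lemma hole_por (a e : R) k j x : (4 <= k)%N -> 0 <= e -> 2^-1 - 2 ^- k < a ->
  a <= por mu x (2 ^- j) e -> exists z, hole e k j x z.
Proof.
move=> k4 e0 ka; have [k0 k16] := invr_exp2_le R k4.
rewrite /por; set S := [set a : R | _] => aS.
(* The supremum of the empty set is 0 by convention, whereas [a] is positive. *)
have S0 : S !=set0.
  by apply/set0P/eqP => S0; move: aS; rewrite S0 sup0; lra.
have [b [b0 [z [zx zmu]]] ab] := sup_gt S0 (lt_le_trans ka aS).
exists z; have sub : cball z ((2^-1 - 2 ^- k) * 2 ^- j) `<=` cball z (b * 2 ^- j).
  by apply: le_cball; rewrite ler_pM2r ?invr_gt0 ?exprn_gt0// ltW.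
split; first exact: subset_trans zx.
by apply: le_trans zmu; exact: le_mu_cball.
Qed.

(** The point [x] is so deep in a hole of some [y] of its cell that the ball of radius
    [2 * 2 ^- (j + k)] around [x] stays inside that hole. The ball of radius [2 ^- j] around [y]
    lies in the one of twice this radius around [x], hence the factor 2 on both sides. *)
Lemma nonexposed_decay e k j x : (0 < d)%N -> (4 <= k)%N -> 0 <= e ->
  (exists z, hole e k j x z) -> ~ exposed (hole e k j) (2 ^- k) j x ->
  (mu (cball x (2 * 2 ^- (j + k))) <= e%:E * mu (cball x (2 * 2 ^- j)))%E.
Proof.
move=> d0 k4 e0 hx nex; have [k0 k16] := invr_exp2_le R k4.
have r0 : 0 < 2 ^- j :> R by rewrite invr_gt0 exprn_gt0.
have [y [z [yx [_ yz] xz]]] : exists y z, [/\ cell y j = cell x j, hole e k j y z &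
    edist x z <= (2^-1 - 3 * 2 ^- k) * 2 ^- j].
  by apply: contrapT => h; apply: nex; split.
apply: (@le_trans _ _ (mu (cball z ((2^-1 - 2 ^- k) * 2 ^- j)))).
  apply: le_mu_cball; apply: cball_subset; rewrite edistC exprD invfM.
  by move: xz; set u := 2 ^- j; set v := 2 ^- k => ?; lra.
apply: le_trans yz _; rewrite lee_wpmul2l ?lee_fin//.
apply: le_mu_cball; apply: cball_subset.
have := cell_edist d0 yx; rewrite edistC => ?; lra.
Qed.

Definition hole_count e k m M x : nat :=
  count (fun l => `[< exists z, hole e k (m + l * k) x z >]) (iota 0 M).

(** These are the scales at which [nonexposed_decay] applies. *)
Definition blind_count e k m M x : nat :=
  count (fun l => `[< exists z, hole e k (m + l * k) x z >] &&
    ~~ `[< exposed (hole e k (m + l * k)) (2 ^- k) (m + l * k) x >]) (iota 0 M).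

Lemma hole_count_le e k m M x :
  (hole_count e k m M x <=
   exposed_count (fun l => hole e k (m + l * k)) k m M x + blind_count e k m M x)%N.
Proof.
rewrite -count_predUI; apply: leq_trans (leq_addr _ _).
by apply: sub_count => l /= ->; case: asboolP.
Qed.

Lemma mu_cball_lty x r : radon mu -> (mu (cball x r) < +oo)%E.
Proof. by case=> h _ _; apply: h; exact: compact_cball. Qed.

Lemma blind_decay e k m M x : (0 < d)%N -> (4 <= k)%N -> 0 <= e ->
  (mu (cball x (2 * 2 ^- (m + M * k))) <=
   (e ^+ blind_count e k m M x)%:E * mu (cball x (2 * 2 ^- m)))%E.
Proof.
move=> d0 k4 e0; elim: M => [|M IH]; first by rewrite mul0n addn0 expr0 mul1e.
have -> : blind_count e k m M.+1 x = (blind_count e k m M x +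
   (`[< exists z, hole e k (m + M * k) x z >] &&
    ~~ `[< exposed (hole e k (m + M * k)) (2 ^- k) (m + M * k) x >]))%N.
  exact: count_iotaS.
rewrite mulSn [(k + _)%N]addnC addnA.
case: asboolP => [hx|_] /=; last first.
  rewrite addn0; apply: le_trans IH; apply: le_mu_cball; apply: le_cball.
  by rewrite ler_pM2l// lef_pV2 ?posrE ?exprn_gt0// ler_eXn2l ?leq_addr// ltr1n.
case: asboolP => [ex|nex] /=.
  rewrite addn0; apply: le_trans IH; apply: le_mu_cball; apply: le_cball.
  by rewrite ler_pM2l// lef_pV2 ?posrE ?exprn_gt0// ler_eXn2l ?leq_addr// ltr1n.
apply: le_trans (nonexposed_decay d0 k4 e0 hx nex) _.
by rewrite addn1 exprS EFinM -muleA lee_wpmul2l ?lee_fin.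
Qed.

(** Otherwise the lower bound and [blind_decay], raised to the power [n], give [base_mass R d k ^+
    (M * n) <= e ^+ M * b ^+ n]. By the choice of [e] this forces [2 ^+ M <= b ^+ n], which fails
    for large [M]. *)
Lemma blind_count_lt (e : R) k m n x : (0 < d)%N -> (4 <= k)%N -> radon mu ->
  0 < e -> e <= base_mass R d k ^+ n / 2 ->
  (exists M0, forall M, (M0 <= M)%N ->
     ((base_mass R d k ^+ M)%:E <= mu (cball x (2 ^- (m + M * k))))%E) ->
  exists M0, forall M, (M0 <= M)%N -> (blind_count e k m M x * n < M)%N.
Proof.
move=> d0 k4 rad e0 eb [M0 hM0].
set B := mu (cball x (2 * 2 ^- m)).
have Bfin : B \is a fin_num by rewrite ge0_fin_numE ?measure_ge0 /B ?mu_cball_lty.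
set b := fine B; have b0 : 0 <= b by rewrite /b fine_ge0 ?measure_ge0.
have bm0 := base_mass_gt0 R k d0.
have bm1 := base_mass_le1 R k d0.
have e1 : e <= 1.
  apply: le_trans eb _; rewrite ler_pdivrMr// mul1r.
  by apply: (@le_trans _ _ 1); [exact: exprn_ile1 (ltW bm0) bm1 | rewrite ler1n].
exists (maxn M0 (Num.truncn (b ^+ n)).+1) => M; rewrite geq_max => /andP[h1 h2].
rewrite ltnNge; apply/negP => hn.
have le1 : base_mass R d k ^+ M <= e ^+ blind_count e k m M x * b.
  rewrite -lee_fin EFinM /b fineK//.
  apply: le_trans (hM0 M h1) (le_trans _ (blind_decay _ _ _ d0 k4 (ltW e0))).
  apply: le_mu_cball; apply: le_cball.
  have : 0 < 2 ^- (m + M * k) :> R by rewrite invr_gt0 exprn_gt0.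
  by lra.
have le2 : base_mass R d k ^+ M ^+ n <= (e ^+ M) * b ^+ n.
  apply: (@le_trans _ _ ((e ^+ blind_count e k m M x * b) ^+ n)).
    by rewrite lerXn2r// nnegrE ?mulr_ge0 ?exprn_ge0// ltW.
  rewrite exprMn ler_wpM2r ?exprn_ge0// -exprM.
  by apply: ler_wiXn2l => //; exact: ltW.
have le3 : 2 ^+ M <= b ^+ n.
  have bMn : 0 < base_mass R d k ^+ M ^+ n by rewrite !exprn_gt0.
  rewrite -(ler_pM2l bMn); apply: le_trans (ler_wpM2r _ le2) _.
    exact: exprn_ge0.
  rewrite mulrAC ler_wpM2r ?exprn_ge0//.
  rewrite -exprM mulnC exprM -exprMn lerXn2r//
    ?nnegrE ?mulr_ge0 ?exprn_ge0 ?(ltW e0) ?(ltW bm0)//.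
  by rewrite -ler_pdivlMr.
have : b ^+ n < M%:R.
  apply: lt_le_trans (truncnS_gt _) _; first by rewrite ler_nat.
rewrite ltNge => /negP; apply; apply: le_trans le3.
by rewrite -natrX ler_nat ltnW// ltn_expl.
Qed.

End Holes.

(** * Local dimension *)

Lemma count_iota (p : pred nat) (a n : nat) :
  count p (iota a n) = (\sum_(m < n) p (a + m))%N.
Proof.
elim: n => [|n IH]; first by rewrite big_ord0.
by rewrite -addn1 iotaD count_cat IH addn1 big_ord_recr /= addn0.
Qed.

Lemma count_residues (p : pred nat) (k M : nat) :
  count p (iota 1 (k * M)) =
  (\sum_(m < k) count (fun l => p (m.+1 + l * k)) (iota 0 M))%N.
Proof.
elim: M => [|M IH]; first by rewrite muln0 big1.
rewrite mulnS addnC iotaD count_cat IH.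
under [RHS]eq_bigr do rewrite count_iotaS.
rewrite big_split /=; congr addn.
rewrite count_iota; apply: eq_bigr => m _.
by congr (nat_of_bool (p _)); lia.
Qed.

Lemma pigeonhole_residue (p : pred nat) (k M : nat) : (0 < k)%N ->
  exists m : 'I_k, (count p (iota 1 (k * M)) <=
    k * count (fun l => p (m.+1 + l * k)) (iota 0 M))%N.
Proof.
move=> k0; pose h (m : 'I_k) := count (fun l => p (m.+1 + l * k)%N) (iota 0 M).
have [|m hm] := @bigop.eq_bigmax _ h; first by rewrite card_ord.
exists m; rewrite count_residues -/(h m) -hm.
rewrite -[X in (X * _)%N](card_ord k) -sum_nat_const.
by apply: leq_sum => i _; exact: (@bigop.leq_bigmax _ h).
Qed.

Section LocalDimension.
Context {R : realType} {d : nat} (mu : {measure set (borelRd R d) -> \bar R}).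
Implicit Types (x : 'rV[R]_d).

Definition has_hole (e : R) (k : nat) x : pred nat :=
  fun j => `[< exists z, hole mu e k j x z >].

(** Here [t] is the number of exposed scales in the residue class richest in holes; the blind scales
    of that class number less than [M / n]. *)
Lemma ae_ball_mass (e : R) (k n : nat) : (0 < d)%N -> (4 <= k)%N -> radon mu ->
  0 < e -> e <= base_mass R d k ^+ n / 2 ->
  exists2 N : set (borelRd R d), mu.-negligible N &
    forall x, ~ N x -> exists M0, forall M, (M0 <= M)%N -> exists2 t,
      (count (has_hole e k x) (iota 1 (k * M)) * n <= k * (t * n + M))%N &
      ((exposed_mass R d k M t)%:E <= mu (cball x (2 ^- (k * M))))%E.
Proof.
move=> d0 k4 rad e0 eb.
have k0 : (0 < k)%N by exact: leq_trans k4.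
have /choice[N NP] (m : nat) : exists N : set (borelRd R d),
    mu.-negligible N /\ forall x, ~ N x ->
      exists M0, forall M, (M0 <= M)%N ->
        (blind_count mu e k m M x * n < M)%N /\
        ((exposed_mass R d k M
            (exposed_count (fun l => hole mu e k (m + l * k)) k m M x))%:E <=
         mu (cball x (2 ^- (m + M * k))))%E.
  have [l x z|N Nn NP] :=
    ae_exposed mu (P := fun l => hole mu e k (m + l * k)) (m := m) d0 k4.
    exact: hole_dist.
  exists N; split => // x /NP[M0 hM0].
  have [|M1 hM1] := blind_count_lt (m := m) (x := x) d0 k4 rad e0 eb.
    exists M0 => M /hM0; apply: le_trans.
    by rewrite lee_fin base_mass_le.
  by exists (maxn M0 M1) => M; rewrite geq_max => /andP[/hM0 ? /hM1 ?].
exists (\bigcup_m N m); first by apply: negligible_bigcup => m; have [] := NP m.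
move=> x Nx.
have /choice[M0 hM0] (m : nat) := (NP m).2 x (fun h => Nx (ex_intro2 _ _ m I h)).
(* The best residue may change with [M], so the threshold must serve all of them. *)
exists (\max_(m < k) M0 m.+1) => M hM.
have [m hm] := pigeonhole_residue (has_hole e k x) M k0.
have [] := hM0 m.+1 M.
  apply: leq_trans hM.
  exact: (@bigop.leq_bigmax _ (fun m : 'I_k => M0 m.+1)).
set t := exposed_count _ _ _ _ _ => blind mass; exists t.
  apply: (@leq_trans (k * hole_count mu e k m.+1 M x * n)).
    by rewrite leq_mul2r hm orbT.
  rewrite -mulnA leq_mul2l; apply/orP; right.
  apply: leq_trans (leq_mul (hole_count_le _ _ _ _ _ _) (leqnn n)) _.
  by rewrite mulnDl leq_add2l ltnW.
apply: le_trans mass _; apply: le_mu_cball; apply: le_cball.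
rewrite lef_pV2 ?posrE ?exprn_gt0// ler_eXn2l ?ltr1n//.
by rewrite mulnC leq_addl.
Qed.

(** Replacing [r] by a radius [2 ^- (k * M)] just below it changes [- ln r] by at most
    [s = k * ln 2], which is negligible as [r] tends to 0. *)
Lemma upper_local_dim_le x (D : R) k M0 : (0 < k)%N -> 0 <= D -> radon mu ->
  (forall M, (M0 <= M)%N ->
    ((expR (- ((k * M)%:R * ln 2 * D)))%:E <= mu (cball x (2 ^- (k * M))))%E) ->
  (upper_local_dim mu x <= D%:E)%E.
Proof.
move=> k0 D0 rad hM0; apply/lee_addgt0Pr => dl dl0.
have l2 : 0 < ln 2 :> R by rewrite ln_gt0// ltr1n.
set s := k%:R * ln 2 : R.
have s0 : 0 < s by rewrite mulr_gt0// ltr0n.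
(* The three terms ensure [r < 1], [M0 <= M], and that the rounding error [D * s] is below
   [dl * v]. *)
pose L := Num.max 0 (Num.max (M0%:R * s) (D * s / dl)).
apply: (@le_trans _ _ (ereal_sup [set (lne (mu (cball x r)) * ((ln r)^-1)%:E)%E
    | r in [set r | 0 < r < expR (- L)]])).
  apply: ereal_inf_lbound; exists [set r | 0 < r < expR (- L)] => //.
  near=> r; apply/andP; split; near: r; first exact: nbhs_right_gt.
  by apply: nbhs_right_lt; exact: expR_gt0.
apply: ub_ereal_sup => _ [r /= /andP[r0 rL] <-].
set v := - ln r.
have Lv : L < v by rewrite /v ltrNr -[- L]expRK ltr_ln// posrE expR_gt0.
have [v0 [vM vD]] : 0 < v /\ M0%:R * s < v /\ D * s / dl < v.
  by move: Lv; rewrite !gt_max => /andP[-> /andP[-> ->]].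
set M := (Num.truncn (v / s)).+1.
have vs0 : 0 <= v / s by rewrite divr_ge0// ltW.
have M1 : v / s < M%:R by rewrite truncnS_gt.
have M2 : M%:R <= v / s + 1 by rewrite -natr1 lerD2r truncn_le.
rewrite ltr_pdivrMr// in M1.
have M2' : M%:R * s <= v + s.
  by rewrite -ler_pdivlMr// mulrDl divff// gt_eqF.
have M0M : (M0 <= M)%N.
  by rewrite -(ler_nat R) -(ler_pM2r s0); lra.
have Mr : 2 ^- (k * M) <= r.
  rewrite -[leRHS]lnK ?posrE// -[leLHS]lnK ?posrE ?invr_gt0 ?exprn_gt0//.
  rewrite ler_expR lnV ?posrE ?exprn_gt0// lnXn// -[ln 2 *+ _]mulr_natl natrM.
  by move: M1; rewrite /v /s; lra.
have := hM0 M M0M; set E := expR _ => hE.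
have mfin : mu (cball x r) \is a fin_num.
  by rewrite ge0_fin_numE ?measure_ge0 ?mu_cball_lty.
have hm : (E%:E <= mu (cball x r))%E.
  by apply: le_trans hE _; apply: le_mu_cball; exact: le_cball.
have E0 : 0 < E by exact: expR_gt0.
rewrite -(fineK mfin) lee_fin in hm *.
have m0 := lt_le_trans E0 hm.
rewrite lne_EFin// -EFinM -EFinD lee_fin.
rewrite -[ln r]opprK -/v invrN mulrN -mulNr ler_pdivrMr//.
have : - (M%:R * s * D) <= ln (fine (mu (cball x r))).
  rewrite -[leLHS]expRK ler_ln ?posrE ?expR_gt0//.
  by apply: le_trans hm; rewrite /E /s natrM [k%:R * M%:R]mulrC -!mulrA.
have : M%:R * s * D <= (v + s) * D by rewrite ler_wpM2r.
move: vD; rewrite ltr_pdivrMr// => ? ? ?; lra.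
Unshelve. all: by end_near. Qed.

End LocalDimension.

(** * From ball masses to the packing dimension *)

Definition dim_const (R : realType) (d : nat) : R :=
  ln (8 * exposed_const d)%:R / ln 2.

Lemma dim_const_ge0 (R : realType) (d : nat) : (0 < d)%N -> 0 <= dim_const R d.
Proof.
move=> d0; rewrite divr_ge0// ln_ge0 ?ler1n//.
by rewrite muln_gt0 exposed_const_gt0.
Qed.

(** The base-2 logarithm of the mass is [k * t - k * d * M - M * dim_const R d]; insert [p * M <= t]
    and divide by [k * M]. *)
Lemma exposed_mass_ge (R : realType) (d k M t : nat) (p : R) :
  (0 < d)%N -> (0 < k)%N -> p * M%:R <= t%:R ->
  expR (- ((k * M)%:R * ln 2 * (d%:R - p + dim_const R d / k%:R))) <=
  exposed_mass R d k M t.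
Proof.
move=> d0 k0 pt; have k0R : 0 < k%:R :> R by rewrite ltr0n.
have l2 : 0 < ln 2 :> R by rewrite ln_gt0// ltr1n.
have C0 : 0 < (8 * exposed_const d)%:R :> R.
  by rewrite ltr0n muln_gt0 exposed_const_gt0.
rewrite -[leRHS]lnK ?posrE ?(exposed_mass_gt0 R)// ler_expR.
have pow (n : nat) (a : R) : 0 < a -> ln (a ^+ n) = n%:R * ln a.
  by move=> a0; rewrite lnXn// mulr_natl.
rewrite /exposed_mass ln_div ?posrE ?ltr0n ?muln_gt0 ?expn_gt0//; last first.
  by rewrite muln_gt0 exposed_const_gt0.
rewrite [X in _ - ln X]natrM lnM ?posrE ?ltr0n ?expn_gt0//; last first.
  by rewrite muln_gt0 exposed_const_gt0.
set X : R := (8 * exposed_const d)%:R in C0 *.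
rewrite [ln (2 ^ _)%:R](_ : _ = (k%:R * t%:R) * ln 2); last first.
  by rewrite natrX pow// natrM.
rewrite [ln (2 ^ _)%:R](_ : _ = (k%:R * d%:R * M%:R) * ln 2); last first.
  by rewrite natrX pow// !natrM.
rewrite [ln (_ ^ M)%:R](_ : _ = M%:R * ln X); last by rewrite natrX pow.
rewrite natrM.
have -> : - (k%:R * M%:R * ln 2 * (d%:R - p + dim_const R d / k%:R)) =
    k%:R * (p * M%:R) * ln 2 - (M%:R * ln X
     + k%:R * d%:R * M%:R * ln 2).
  rewrite /dim_const -/X; field; rewrite !gt_eqF//.
by rewrite lerD2r ler_pM2r// ler_pM2l.
Qed.

Section PackingDimension.
Context {R : realType} {d : nat} (mu : {measure set (borelRd R d) -> \bar R}).
Implicit Types (x : 'rV[R]_d) (A : set 'rV[R]_d).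

Lemma outer_gt0_not_negligible A (N : set (borelRd R d)) :
  (0 < mu_ext mu A)%E -> mu.-negligible N -> exists2 x, A x & ~ N x.
Proof.
move=> A0 [B [mB B0 NB]]; apply: contrapT => h.
suff : (mu_ext mu A <= 0)%E by rewrite leNgt A0.
rewrite -B0 -(measurable_mu_extE mu mB); apply: le_mu_ext => x Ax.
by apply: NB; apply: contrapT => Nx; apply: h; exists x.
Qed.

(** The admissible [e] may depend on [x]. Restricting to the values [q.+1%:R^-1] leaves countably
    many exceptional sets, and some point of [A] avoids them all. *)
Lemma packing_dim_le A k (p : R) : (0 < d)%N -> (4 <= k)%N -> radon mu ->
  p <= 1 -> (0 < mu_ext mu A)%E ->
  (forall x, A x -> forall (n : nat) (e0 : R), (0 < n)%N -> 0 < e0 ->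
    exists2 q : nat, q.+1%:R^-1 <= e0 &
    exists i0, forall i, (i0 <= i)%N ->
      (p - n%:R^-1) * i%:R <=
      (count (has_hole mu q.+1%:R^-1 k x) (iota 1 i))%:R) ->
  (packing_dim mu <= (d%:R - p + dim_const R d / k%:R)%:E)%E.
Proof.
move=> d0 k4 rad p1 A0 Ahole; apply/lee_addgt0Pr => dl dl0.
have k0 : (0 < k)%N by exact: leq_trans k4.
have kR : 0 < k%:R :> R by rewrite ltr0n.
(* One [n%:R^-1] is lost in the frequency of holes, another to the blind scales. *)
set n := (Num.truncn (2 / dl)).+1.
have n0 : 0 < n%:R :> R by rewrite ltr0n.
have ndl : 2 / n%:R <= dl.
  rewrite ler_pdivrMr// mulrC -ler_pdivrMr//; exact/ltW/truncnS_gt.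
set e0 := base_mass R d k ^+ n / 2.
have e00 : 0 < e0.
  by rewrite divr_gt0// exprn_gt0// base_mass_gt0.
have /choice[N NP] (q : nat) : exists N : set (borelRd R d), mu.-negligible N /\
    (q.+1%:R^-1 <= e0 -> forall x, ~ N x ->
     exists M0, forall M, (M0 <= M)%N -> exists2 t,
      (count (has_hole mu q.+1%:R^-1 k x) (iota 1 (k * M)) * n <=
       k * (t * n + M))%N &
      ((exposed_mass R d k M t)%:E <= mu (cball x (2 ^- (k * M))))%E).
  have [qe|_] := leP (q.+1%:R^-1) e0; last first.
    by exists set0; split => //; exact: negligible_set0.
  have [|N N0 NP] := @ae_ball_mass _ _ mu q.+1%:R^-1 _ n d0 k4 rad _ qe.
    by rewrite invr_gt0.
  by exists N.
have N0 : mu.-negligible (\bigcup_q N q).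
  by apply: negligible_bigcup => q; have [] := NP q.
(* Almost everywhere the upper local dimension is at least [packing_dim mu], so bounding it at one
   good point of [A] suffices. *)
have /ess_infP yN : (packing_dim mu <= ess_inf mu (upper_local_dim mu))%E by [].
have [x Ax] := outer_gt0_not_negligible A0 (negligibleU yN N0).
move=> /not_orP[/contrapT yx Nx].
apply: le_trans yx _.
have [q qe [i0 hi0]] := Ahole x Ax n e0 isT e00.
have [M0 hM0] := (NP q).2 qe x (fun h => Nx (ex_intro2 _ _ q I h)).
have c0 := dim_const_ge0 R d0; have dR : 1 <= d%:R :> R by rewrite ler1n.
apply: (@le_trans _ _ (d%:R - (p - 2 / n%:R) + dim_const R d / k%:R)%:E); last first.
  by rewrite -EFinD lee_fin; lra.
apply: (@upper_local_dim_le _ _ _ _ _ k (maxn M0 i0)) => //.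
  have : 0 <= dim_const R d / k%:R by rewrite divr_ge0// ltW.
  have : 0 <= 2 / n%:R :> R by rewrite divr_ge0// ltW.
  by lra.
move=> M; rewrite geq_max => /andP[/hM0[t ht mass] iM].
apply: le_trans mass; rewrite lee_fin; apply: exposed_mass_ge => //.
have := hi0 (k * M)%N (leq_trans iM (leq_pmull _ k0)).
move: ht; set c := count _ _ => ht hc.
move: ht; rewrite -(ler_nat R) !natrM natrD natrM => ht.
rewrite natrM in hc.
have h1 : (p - n%:R^-1) * (k%:R * M%:R) * n%:R <= k%:R * (t%:R * n%:R + M%:R).
  by apply: le_trans ht; rewrite ler_pM2r.
have h2 : (p - n%:R^-1) * (k%:R * M%:R) * n%:R =
  k%:R * ((p - n%:R^-1) * M%:R * n%:R) by ring.
rewrite h2 ler_pM2l// in h1.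
rewrite -(ler_pM2r n0).
have h3 : (p - 2 / n%:R) * M%:R * n%:R = (p - n%:R^-1) * M%:R * n%:R - M%:R.
  by field; rewrite gt_eqF.
by rewrite h3; lra.
Qed.

Lemma limn_einf_gt (u : (\bar R)^nat) (s : \bar R) : (s < limn_einf u)%E ->
  exists i0, forall i, (i0 <= i)%N -> (s < u i)%E.
Proof.
rewrite limn_einf_lim (cvg_lim _ (@cvg_einfs_sup _ u))//.
move=> /ereal_sup_gt[_ [i0 _ <-] h]; exists i0 => i i0i.
by apply: lt_le_trans h _; apply: ereal_inf_lbound; exists i.
Qed.

Lemma mean_porous_holes (a p : R) k x : (4 <= k)%N -> 2^-1 - 2 ^- k < a ->
  0 < p -> mean_porous_at mu a p x ->
  forall (n : nat) (e0 : R), (0 < n)%N -> 0 < e0 ->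
    exists2 q : nat, q.+1%:R^-1 <= e0 &
    exists i0, forall i, (i0 <= i)%N ->
      (p - n%:R^-1) * i%:R <=
      (count (has_hole mu q.+1%:R^-1 k x) (iota 1 i))%:R.
Proof.
move=> k4 ka p0; rewrite /mean_porous_at; set g := (fun e : R => limn_einf _).
move=> hp n e0 n0 e00.
(* A divergent [lim] has the default value 0, which is excluded by [0 < p]. *)
have gcvg : cvg (g e @[e --> 0^'+]).
  by apply: contrapT => /dvgP gl; move: hp; rewrite gl lee_fin leNgt p0.
have : \forall e \near 0^'+, ((p - n%:R^-1)%:E < g e)%E.
  apply: (gcvg [set y | ((p - n%:R^-1)%:E < y)%E]).
  apply: open_nbhs_nbhs; split; first exact: open_ereal_gt_ereal.
  apply: lt_le_trans hp; rewrite lte_fin ltrBlDr ltrDl.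
  by rewrite invr_gt0 ltr0n.
case=> /= eps eps0 geps.
set q := Num.truncn (Num.min e0 eps)^-1.
have m0 : 0 < Num.min e0 eps by rewrite lt_min e00.
have qm : q.+1%:R^-1 < Num.min e0 eps.
  by rewrite -[ltRHS]invrK ltf_pV2 ?posrE ?invr_gt0//; exact: truncnS_gt.
move: qm; rewrite lt_min => /andP[qe0 qeps].
have qpos : 0 < q.+1%:R^-1 :> R by rewrite invr_gt0.
exists q; first exact: ltW.
have /limn_einf_gt[i0 hi0] : ((p - n%:R^-1)%:E < g (q.+1%:R^-1)%R)%E.
  by apply: geps => //; rewrite /ball/= sub0r normrN gtr0_norm.
exists i0 => i /hi0; rewrite lte_fin.
have [->|ipos] := posnP i; first by rewrite mulr0.
rewrite ltr_pdivlMr ?ltr0n// => /ltW/le_trans; apply.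
rewrite ler_nat; apply: sub_count => j /= ha; apply/asboolP.
exact: hole_por ha.
Qed.

End PackingDimension.

(** * Choice of the scale step in terms of the porosity *)

Theorem theorem3p1 (R : realType) (d : nat) (hd : (0 < d)%N) :
  exists C : R, forall (a p : R) (mu : {measure set (borelRd R d) -> \bar R}),
    0 <= a -> a <= 2^-1 -> 0 < p -> p <= 1 ->
    radon mu -> mean_porous mu a p ->
    (packing_dim mu <= (d%:R - p)%:E + porosity_error C a)%E.
Proof.
set c := dim_const R d; have c0 : 0 <= c by exact: dim_const_ge0.
have l2 : 0 < ln 2 :> R by rewrite ln_gt0// ltr1n.
(* The factor [3 * ln 2] comes from the case [k <= 3] below, where [ln (1 / b) <= 3 * ln 2]; the
   summand 1 compensates [p <= 1] there. *)
exists (3 * ln 2 * (c + 1)) => a p mu a0 a2 p0 p1 rad [A [A0 Apor]].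
have bound k : (4 <= k)%N -> 2^-1 - 2 ^- k < a ->
    (packing_dim mu <= (d%:R - p + c / k%:R)%:E)%E.
  move=> k4 ka; apply: (packing_dim_le hd k4 rad p1 A0) => x /Apor.
  exact: mean_porous_holes.
rewrite /porosity_error; have [_|an0] := eqVneq a 0; first by rewrite addey// leey.
have ap : 0 < a by rewrite lt_neqAle eq_sym an0.
have [a_half|a_half] := eqVneq a 2^-1.
  (* For [a = 2^-1] every [k] is admissible, and [c / k] becomes arbitrarily small. *)
  rewrite adde0; apply/lee_addgt0Pr => e e0.
  set k := maxn 4 (Num.truncn (c / e)).+1.
  have k0 : 0 < k%:R :> R by rewrite ltr0n leq_max.
  apply: le_trans (bound k _ _) _; first exact: leq_maxl.
    by rewrite a_half ltrBlDr ltrDl invr_gt0 exprn_gt0.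
  rewrite -EFinD lee_fin lerD2l ler_pdivrMr// mulrC -ler_pdivrMr//.
  by apply: ltW (lt_le_trans (truncnS_gt _) _); rewrite ler_nat leq_maxr.
have b0 : 0 < 1 - 2 * a.
  have : a < 2^-1 by rewrite lt_neqAle a_half.
  by lra.
have b1 : 1 - 2 * a < 1 by lra.
set b := 1 - 2 * a in b0 b1 *.
have L0 : 0 < ln (1 / b) by rewrite ln_gt0// div1r invf_gt1.
have exk : exists k, 2 ^- k <= b.
  exists (Num.truncn b^-1).+1.
  rewrite -[leRHS]invrK lef_pV2 ?posrE ?exprn_gt0 ?invr_gt0//.
  apply: ltW (lt_le_trans (truncnS_gt _) _).
  by rewrite -natrX ler_nat ltnW// ltn_expl.
(* Minimality of [k] yields [b < 2 * 2 ^- k], that is [2^-1 - 2 ^- k < a], while [2 ^- k <= b]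
   bounds [ln (1 / b)] by [k * ln 2]. *)
have [k kb kmin] := ex_minnP exk.
have Lk : ln (1 / b) <= k%:R * ln 2.
  rewrite mulr_natl -lnXn// ler_ln ?posrE ?divr_gt0 ?exprn_gt0//.
  by rewrite div1r -[leRHS]invrK lef_pV2 ?posrE ?invr_gt0 ?exprn_gt0.
rewrite -EFinD; have [k4|k4] := leqP 4 k.
  apply: le_trans (bound k k4 _) _.
    have : b < 2 ^- k.-1.
      rewrite ltNge; apply/negP => /kmin; case: k k4 {kb kmin Lk} => // k _.
      by rewrite /= ltnn.
    have -> : 2 ^- k.-1 = 2 * 2 ^- k :> R.
      case: k k4 {kb kmin Lk} => // k _; rewrite /= exprS invfM mulrA divff ?mul1r//.
    by rewrite /b; lra.
  have k0 : 0 < k%:R :> R by rewrite ltr0n; exact: leq_trans k4.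
  rewrite lee_fin lerD2l ler_pdivlMr// mulrAC ler_pdivrMr//.
  apply: (@le_trans _ _ (c * (k%:R * ln 2))); first by rewrite ler_wpM2l.
  rewrite -subr_ge0 [leRHS](_ : _ = k%:R * ln 2 * (2 * c + 3)); last by ring.
  by rewrite !mulr_ge0 ?(ltW l2) ?(ltW k0)//; lra.
(* For [k < 4] the error term is at least [c + 1], so a bound without holes is enough: frequency 0
   and step 4. *)
have bound0 : (packing_dim mu <= (d%:R - 0 + c / 4%:R)%:E)%E.
  apply: (packing_dim_le hd (leqnn 4) rad ler01 A0) => x _ n e0 n0 e00.
  exists (Num.truncn e0^-1).
    rewrite -[leRHS]invrK lef_pV2 ?posrE ?invr_gt0//; exact/ltW/truncnS_gt.
  exists 0%N => i _; apply: le_trans (ler0n _ _).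
  by apply: mulr_le0_ge0 => //; rewrite sub0r oppr_le0 invr_ge0.
apply: le_trans bound0 _; rewrite lee_fin.
have : c + 1 <= 3 * ln 2 * (c + 1) / ln (1 / b).
  rewrite ler_pdivlMr// mulrC ler_wpM2r ?addr_ge0//.
  apply: le_trans Lk _; rewrite ler_wpM2r// ?ler_nat//; exact: ltW.
by lra.
Qed.
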